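(* Let $\mathcal{A}=\{0,\ldots,n-1\}$ for some $n\in\mathbb{N}$ and let $l:\mathcal{A}\rightarrow\mathbb{N}$ satisfy $$\sum_{i\in\mathcal{A},\ l(i)\neq 0}2^{-l(i)}\le 1.$$ Then there is a Deflate coding $\lceil\cdot\rceil:\mathcal{A}\rightarrow\{0,1\}^*$ such that $l(x)=\operatorname{len}\lceil x\rceil$ for all $x\in\mathcal{A}$.
   Context: $\{0,1\}^*$ is the set of finite bit lists, $[\,]$ is the empty list, $::$ is cons, $+\!\!+$ is concatenation, $\{0,1\}^+$ is the set of nonempty bit lists. For bit lists $a,b$, write $a\preccurlyeq b$ ($a$ is a prefix of $b$) if there is $c\in\{0,1\}^*$ with $a+\!\!+c=b$. The lexicographical ordering $\sqsubseteq$ on $\{0,1\}^*$ is the least relation with $[\,]\sqsubseteq a$ for all $a$; $0::a\sqsubseteq 1::b$ for all $a,b$; and $j::a\sqsubseteq j::b$ whenever $a\sqsubseteq b$ (for $j\in\{0,1\}$). A Deflate coding is a map $\lceil\cdot\rceil:\mathcal{A}\to\{0,1\}^*$ such that: (1) for all $a\neq b$ with $\lceil a\rceil\neq[\,]$, $\lceil a\rceil\not\preccurlyeq\lceil b\rceil$; (2) for all $a,b$, if $\operatorname{len}\lceil a\rceil<\operatorname{len}\lceil b\rceil$ then $\lceil a\rceil\sqsubseteq\lceil b\rceil$; (3) for all $a,b$, if $\operatorname{len}\lceil a\rceil=\operatorname{len}\lceil b\rceil$ and $a\le b$ then $\lceil a\rceil\sqsubseteq\lceil b\rceil$; (4) for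 all $a\in\mathcal{A}$ and $l\in\{0,1\}^+$, if $l\sqsubseteq\lceil a\rceil$ and $\operatorname{len} l=\operatorname{len}\lceil a\rceil$, then there exists $b\in\mathcal{A}$ with $\lceil b\rceil\neq[\,]$ and $\lceil b\rceil\preccurlyeq l$. *)

(* Defs.v *)
From mathcomp Require Import all_boot all_order all_algebra.
Set Implicit Arguments.
Unset Strict Implicit.
Unset Printing Implicit Defensive.

(* Bit lists are [seq bool], with [false] for 0 and [true] for 1. *)
Inductive lexle : seq bool -> seq bool -> Prop :=
| lexle_nil (a : seq bool) : lexle [::] a
| lexle_lt (a b : seq bool) : lexle (false :: a) (true :: b)
| lexle_cons (j : bool) (a b : seq bool) :
    lexle a b -> lexle (j :: a) (j :: b).

(* The empty code word marks a symbol that is not used; [prefix] is the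
   non-strict prefix relation of the library. *)
Record deflate_coding (n : nat) (code : 'I_n -> seq bool) : Prop :=
  DeflateCoding {
    deflate_prefix_free : forall a b : 'I_n,
      a <> b -> code a <> [::] -> ~ prefix (code a) (code b);
    deflate_lex_short : forall a b : 'I_n,
      size (code a) < size (code b) -> lexle (code a) (code b);
    deflate_lex_same : forall a b : 'I_n,
      size (code a) = size (code b) -> a <= b -> lexle (code a) (code b);
    deflate_no_gap : forall (a : 'I_n) (s : seq bool),
      s <> [::] -> lexle s (code a) -> size s = size (code a) ->
      exists b : 'I_n, code b <> [::] /\ prefix (code b) s
  }.

(* Main.v *)
Require Import Defs.
From mathcomp Require Import all_boot all_order all_algebra.
From mathcomp Require Import zify.
Set Implicit Arguments.
Unset Strict Implicit.
Unset Printing Implicit Defensive.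
Import Order.TTheory GRing.Theory Num.Theory.

(** A word [s] of length at most [N] is identified with the dyadic interval
    [[bval s * 2 ^ (N - size s), (bval s + 1) * 2 ^ (N - size s)[] of
    [[0, 2 ^ N[]; prefixes correspond to inclusion of intervals and the
    lexicographic order to the order of left endpoints.  Laying the intervals
    of the used symbols side by side from [0], in order of increasing length
    and then of increasing symbol, makes each left endpoint a multiple of the
    width, hence the interval of a word; Kraft's inequality says that they all
    fit, and the absence of gaps between them is condition (4). *)

Local Open Scope nat_scope.

Fixpoint bval (s : seq bool) : nat :=
  if s is b :: s' then b * 2 ^ size s' + bval s' else 0.

Fixpoint bits (k m : nat) : seq bool :=
  if k is k'.+1 then (2 ^ k' <= m) :: bits k' (m %% 2 ^ k') else [::].

Lemma size_bits k m : size (bits k m) = k.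
Proof. by elim: k m => //= k IHk m; rewrite IHk. Qed.

Lemma bitsK k m : m < 2 ^ k -> bval (bits k m) = m.
Proof.
elim: k m => [|k IHk] m /=; first by case: m.
rewrite expnS size_bits => lt_m; rewrite IHk ?ltn_mod ?expn_gt0 //.
rewrite [RHS](divn_eq m (2 ^ k)); congr (_ * _ + _).
case: leqP => [le_m|lt_m']; last by rewrite divn_small.
have : m %/ 2 ^ k < 2 by rewrite ltn_divLR ?expn_gt0.
have : 0 < m %/ 2 ^ k by rewrite divn_gt0 ?expn_gt0.
by case: (m %/ 2 ^ k) => [|[]].
Qed.

Lemma bval_lt s : bval s < 2 ^ size s.
Proof. by elim: s => //= -[] s; rewrite expnS; lia. Qed.

Lemma bval_cat s t : bval (s ++ t) = bval s * 2 ^ size t + bval t.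
Proof.
elim: s => //= b s ->.
by rewrite size_cat expnD addnA mulnDl mulnA.
Qed.

Lemma bval_inj s t : size s = size t -> bval s = bval t -> s = t.
Proof.
elim: s t => [|b s IHs] [|c t] //= [eq_st]; have := bval_lt s.
have := bval_lt t; rewrite -eq_st => lt_t lt_s eq_v.
have eq_bc : b = c by case: b c eq_v => [] []; lia.
by rewrite eq_bc in eq_v *; rewrite (IHs t) //; lia.
Qed.

Definition left_end (N : nat) (s : seq bool) : nat := bval s * 2 ^ (N - size s).

(** In units of [2 ^ (N - size t)], the right-hand side says that [bval s] is the quotient of
    [bval t] by [2 ^ (size t - size s)], which is the value of the first [size s] bits of [t]. *)
Lemma prefix_left_end N s t : size s <= size t -> size t <= N ->
  prefix s t =
    (left_end N s <= left_end N t < left_end N s + 2 ^ (N - size s)).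
Proof.
move=> le_st le_tN; rewrite prefixE /left_end.
have def_w : 2 ^ (N - size s) = 2 ^ (size t - size s) * 2 ^ (N - size t).
  by rewrite -expnD; congr (_ ^ _); lia.
have sz_take : size (take (size s) t) = size s by rewrite size_take_min; lia.
rewrite def_w mulnA -mulnDl leq_pmul2r ?expn_gt0 // ltn_pmul2r ?expn_gt0 //.
have := bval_cat (take (size s) t) (drop (size s) t).
have := bval_lt (drop (size s) t); rewrite cat_take_drop size_drop.
set r := bval (drop _ _); set w := 2 ^ _ => lt_rw ->.
apply/eqP/idP => [->|]; first by rewrite leq_addr ltn_add2l.
rewrite -mulSnr => /andP[le_v lt_v]; apply: bval_inj => //.
by nia.
Qed.

(** The bound on sizes settles ties: padding a word with zeros keeps its left endpoint but moves it
    up lexicographically. *)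
Lemma lexle_left_end N s t : size s <= size t -> size t <= N ->
  left_end N s <= left_end N t -> lexle s t.
Proof.
move=> le_st le_tN; rewrite /left_end.
have -> : 2 ^ (N - size s) = 2 ^ (size t - size s) * 2 ^ (N - size t).
  by rewrite -expnD; congr (_ ^ _); lia.
rewrite mulnA leq_pmul2r ?expn_gt0 // => {N le_tN}.
elim: s t le_st => [|b s IHs] [|c t] //=; try by move=> *; apply: lexle_nil.
rewrite ltnS subSS => le_st; rewrite mulnDl -mulnA -expnD subnKC //.
case: b c => [] []; rewrite ?mul1n ?mul0n ?add0n ?leq_add2l.
- by move=> /(IHs _ le_st) /(lexle_cons true).
- by have := bval_lt t; lia.
- by move=> _; apply: lexle_lt.
- by move=> /(IHs _ le_st) /(lexle_cons false).
Qed.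

Lemma bval_lexle s t : lexle s t -> size s = size t -> bval s <= bval t.
Proof.
elim=> {s t} [t|s t|b s t _ IHst] //= [eq_st].
  by have := bval_lt s; rewrite eq_st; lia.
by rewrite eq_st leq_add2l IHst.
Qed.

(** As [a < n], this encodes the lexicographic order on the pairs [(l a, a)] in a single number. *)
Definition rank (n : nat) (l : 'I_n -> nat) (a : 'I_n) : nat := l a * n + a.

Lemma rank_len n (l : 'I_n -> nat) a b : rank l a < rank l b -> l a <= l b.
Proof. by rewrite /rank => lt_ab; have := ltn_ord a; have := ltn_ord b; nia. Qed.

Lemma len_rank n (l : 'I_n -> nat) a b : l a < l b -> rank l a < rank l b.
Proof. by rewrite /rank => lt_ab; have := ltn_ord a; have := ltn_ord b; nia. Qed.

Lemma rank_inj n (l : 'I_n -> nat) : injective (rank l).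
Proof.
move=> a b eq_ab; have [lt_l|lt_l|eq_l] := ltngtP (l a) (l b).
- by have := len_rank lt_l; rewrite eq_ab ltnn.
- by have := len_rank lt_l; rewrite eq_ab ltnn.
by apply: val_inj; move/eqP: eq_ab; rewrite /rank eq_l eqn_add2l => /eqP.
Qed.

Definition offset (n N : nat) (l : 'I_n -> nat) (a : 'I_n) : nat :=
  \sum_(b < n | (l b != 0) && (rank l b < rank l a)) 2 ^ (N - l b).

(** The sum [offset N l b] contains the term of [a] and, besides it, every term of
    [offset N l a]. *)
Lemma offset_ltn n N (l : 'I_n -> nat) a b : l a != 0 ->
  rank l a < rank l b -> offset N l a + 2 ^ (N - l a) <= offset N l b.
Proof.
move=> la0 lt_ab; rewrite addnC {2}/offset (bigD1 a) ?la0 //= leq_add2l.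
rewrite /offset big_mkcond [leqRHS]big_mkcond; apply: leq_sum => c _.
case: ifP => // /andP[lc0 lt_ca]; rewrite lc0 (ltn_trans lt_ca lt_ab) /=.
by case: eqP lt_ca => // ->; rewrite ltnn.
Qed.

Lemma offset_le_sum n N (l : 'I_n -> nat) a : l a != 0 ->
  offset N l a + 2 ^ (N - l a) <= \sum_(i < n | l i != 0) 2 ^ (N - l i).
Proof.
move=> la0; rewrite addnC [leqRHS](bigD1 a) //= leq_add2l.
rewrite /offset big_mkcond [leqRHS]big_mkcond; apply: leq_sum => c _.
case: ifP => // /andP[lc0 lt_ca]; rewrite lc0 /=.
by case: eqP lt_ca => // ->; rewrite ltnn.
Qed.

(** Symbols of smaller rank have words that are no longer, so their widths are multiples of the
    width of [a]. *)
Lemma dvdn_offset n N (l : 'I_n -> nat) a : 2 ^ (N - l a) %| offset N l a.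
Proof.
apply: dvdn_sum => b /andP[_ /rank_len le_ba].
by rewrite dvdn_exp2l // leq_sub2l.
Qed.

Lemma offset_cover n N (l : 'I_n -> nat) a v : l a != 0 ->
    v < offset N l a + 2 ^ (N - l a) ->
  exists b : 'I_n, [/\ l b != 0, rank l b <= rank l a
    & offset N l b <= v < offset N l b + 2 ^ (N - l b)].
Proof.
have [m] := ubnP (rank l a); elim: m a => // m IHm a lt_am la0 lt_v.
have [le_v|gt_v] := leqP (offset N l a) v; first by exists a; rewrite le_v.
pose P (c : 'I_n) := (l c != 0) && (rank l c < rank l a).
(* Without an earlier used symbol, [offset N l a] is an empty sum and cannot exceed [v]. *)
have [c0 Pc0 | noP] := pickP P; last first.
  by move: gt_v; rewrite /offset big_pred0.
have [c /andP[lc0 lt_ca] c_max] := arg_maxnP (rank l) Pc0.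
(* The interval of [c], the last used symbol before [a], ends exactly where that of [a] starts, so
   the induction can pass to [c]. *)
have def_a : offset N l a = offset N l c + 2 ^ (N - l c).
  rewrite addnC {1}/offset (bigD1 c) ?lc0 //=; congr (_ + _).
  apply: eq_bigl => d; case: (eqVneq (l d) 0) => //= ld0.
  apply/andP/idP => [[lt_da ne_dc] | lt_dc].
    rewrite ltn_neqAle (inj_eq (@rank_inj _ l)) ne_dc /=.
    by apply: c_max; rewrite /P ld0.
  rewrite (ltn_trans lt_dc lt_ca); split=> //.
  by case: eqP lt_dc => // ->; rewrite ltnn.
have [||b [lb0 le_bc in_b]] := IHm c _ lc0; first exact: leq_trans lt_ca _.
  by rewrite -def_a.
by exists b; split=> //; apply: leq_trans le_bc (ltnW lt_ca).
Qed.

Definition canonical_code (n N : nat) (l : 'I_n -> nat) (a : 'I_n) : seq bool :=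
  bits (l a) (offset N l a %/ 2 ^ (N - l a)).

Lemma size_canonical_code n N (l : 'I_n -> nat) a :
  size (canonical_code N l a) = l a.
Proof. exact: size_bits. Qed.

Lemma canonical_code_nil n N (l : 'I_n -> nat) a :
  canonical_code N l a <> [::] <-> l a != 0.
Proof.
by rewrite -(size_canonical_code N l a) size_eq0; split=> [/eqP|/eqP].
Qed.

Lemma left_end_canonical_code n N (l : 'I_n -> nat) a :
    l a <= N -> l a != 0 -> \sum_(i < n | l i != 0) 2 ^ (N - l i) <= 2 ^ N ->
  left_end N (canonical_code N l a) = offset N l a.
Proof.
move=> laN la0 kraft; rewrite /left_end size_canonical_code bitsK.
  by rewrite divnK ?dvdn_offset.
(* Kraft's inequality keeps the quotient below [2 ^ l a], so that [bits] loses nothing. *)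
rewrite ltn_divLR ?expn_gt0 // -expnD subnKC //.
apply: leq_trans (leq_trans (offset_le_sum N la0) kraft).
by rewrite -addn1 leq_add2l expn_gt0.
Qed.

Lemma canonical_code_deflate n N (l : 'I_n -> nat) :
    (forall i, l i <= N) -> \sum_(i < n | l i != 0) 2 ^ (N - l i) <= 2 ^ N ->
  deflate_coding (canonical_code N l).
Proof.
move=> leN kraft.
have endE a : l a != 0 -> left_end N (canonical_code N l a) = offset N l a.
  by move=> la0; apply: left_end_canonical_code.
have lex_rank a b : rank l a < rank l b ->
    lexle (canonical_code N l a) (canonical_code N l b).
  move=> lt_ab; have le_ab := rank_len lt_ab.
  have [la0|la0] := eqVneq (l a) 0.
    by rewrite /canonical_code la0; apply: lexle_nil.
  have lb0 : l b != 0 by lia.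
  apply: (@lexle_left_end N); rewrite ?size_canonical_code ?endE //.
  exact: leq_trans (leq_addr _ _) (offset_ltn N la0 lt_ab).
split=> [a b ne_ab /canonical_code_nil la0 pre_ab|a b|a b|a s s0].
- have le_ab : l a <= l b.
    by have := size_prefix pre_ab; rewrite !size_canonical_code.
  have lb0 : l b != 0 by lia.
  move: pre_ab; rewrite (prefix_left_end (N := N)) ?size_canonical_code //.
  rewrite !endE // => /andP[le_off lt_off].
  (* Distinct ranks give disjoint intervals, so the left endpoint of [b] cannot lie in the interval
     of [a]. *)
  have [lt_r|lt_r|/rank_inj //] := ltngtP (rank l a) (rank l b).
    by have := offset_ltn N la0 lt_r; lia.
  by have := offset_ltn N lb0 lt_r; have := expn_gt0 2 (N - l b); lia.
- by rewrite !size_canonical_code => /(len_rank (l := l)); apply: lex_rank.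
- rewrite !size_canonical_code => eq_l; rewrite leq_eqVlt => /predU1P[eq_ab|lt_ab].
    rewrite (val_inj eq_ab).
    by apply: (@lexle_left_end N); rewrite ?size_canonical_code.
  by apply: lex_rank; rewrite /rank eq_l ltn_add2l.
move=> lex_sa eq_sz; have le_v := bval_lexle lex_sa eq_sz.
rewrite size_canonical_code in eq_sz.
have la0 : l a != 0 by rewrite -eq_sz size_eq0; apply/eqP.
have le_end : left_end N s <= offset N l a.
  by rewrite -endE // /left_end size_canonical_code eq_sz leq_mul2r le_v orbT.
(* The endpoint of [s] lies in the gapless region up to the end of the interval of [a]; the symbol
   whose interval contains it provides the prefix. *)
have [|b [lb0 le_ba in_b]] := @offset_cover n N l a (left_end N s) la0.
  by have := expn_gt0 2 (N - l a); lia.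
exists b; split; first exact/canonical_code_nil.
have le_l : l b <= l a by case: ltngtP le_ba => // [/rank_len|/rank_inj->].
by rewrite (prefix_left_end (N := N)) ?size_canonical_code ?endE ?eq_sz.
Qed.

Local Open Scope ring_scope.

(** Both sides are scaled by [2 ^ N]; the bound on [l] makes each truncated subtraction [N - l i]
    exact. *)
Lemma kraft_natE n N (l : 'I_n -> nat) : (forall i, (l i <= N)%N) ->
  (\sum_(i < n | l i != 0%N) (2%:R ^- l i : rat) <= 1) =
  (\sum_(i < n | l i != 0) 2 ^ (N - l i) <= 2 ^ N)%N.
Proof.
move=> leN; rewrite -(ler_nat rat) natr_sum natrX.
rewrite -[LHS](@ler_pM2r _ (2%:R ^+ N)) ?exprn_gt0 // mul1r mulr_suml.
congr (_ <= _); apply: eq_bigr => i _.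
by rewrite natrX -{1}(subnK (leN i)) exprD mulrC mulfK // expf_neq0.
Qed.

Theorem theorem3 (n : nat) (l : 'I_n -> nat)
    (hl : \sum_(i < n | l i != 0%N) (2%:R ^- l i : rat) <= 1) :
  exists code : 'I_n -> seq bool,
    deflate_coding code /\ forall x : 'I_n, l x = size (code x).
Proof.
(* The largest length serves as the common resolution [N]. *)
have leN i : (l i <= \max_(j < n) l j)%N by apply: leq_bigmax.
exists (canonical_code (\max_(j < n) l j) l); split=> [|x].
  by apply: canonical_code_deflate; rewrite // -kraft_natE.
by rewrite size_canonical_code.
Qed.
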